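(* Let $d\ge 2$ be a prime power and let $p_d$ denote the $d$-th prime (with $p_1=2,p_2=3,\dots$). Then for every integer $N\ge 2^d p_d$, $$\rho_d(N)=\sum_{k=1}^{d-1}\pi\left(\frac{N}{k}\right),$$ where $\pi(x)$ denotes the number of primes not exceeding $x$.
   Context: For positive integers $d$ and $N$, $\rho_d(N)$ denotes the maximum size of a set $A\subseteq\{1,2,\dots,N\}$ such that there are no $\ell\ge 1$, pairwise distinct $a_1,\dots,a_\ell\in A$ and integer $x$ with $a_1a_2\cdots a_\ell=x^d$ (i.e., no product of distinct elements of $A$ is a perfect $d$-th power). *)

(* Defs.v *)
From mathcomp Require Import all_boot all_order all_algebra boolp.

Set Implicit Arguments.
Unset Strict Implicit.
Unset Printing Implicit Defensive.

Import Order.TTheory GRing.Theory Num.Theory.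
Local Open Scope ring_scope.

(* Elements of [A] represent the integers 0, ..., N; [rho] excludes 0.
   The list [s] enumerates the pairwise distinct factors a_1, ..., a_l. *)
Definition dpower_free (d N : nat) (A : {set 'I_N.+1}) : Prop :=
  forall s : seq 'I_N.+1,
    s != [::] -> uniq s -> {subset s <= A} ->
    ~ exists x : int, (\prod_(a <- s) (a : nat))%N%:Z = x ^+ d.

(* The maximum is over a nonempty family, since [set0] is admissible. *)
Definition rho (d N : nat) : nat :=
  (\max_(A : {set 'I_N.+1} |
         [forall a in A, 0 < (a : nat)] && `[< dpower_free d A >]) #|A|)%N.

(* Bounding the index by the integer part of [x] only makes the range finite. *)
Definition primepi (R : archiRealFieldType) (x : R) : nat :=
  #|[set p : 'I_(Num.truncn x).+1 | prime p & (p : nat)%:R <= x]|.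

Lemma ex_prime_gt (m : nat) : exists p, prime p && (m < p)%N.
Proof. by have [p ltmp prp] := prime_above m; exists p; rewrite prp. Qed.

Definition next_prime (m : nat) : nat := ex_minn (ex_prime_gt m).

(* [nth_prime 1 = 2], [nth_prime 2 = 3], ...; the value at 0 is a dummy. *)
Definition nth_prime (d : nat) : nat := iter d next_prime 0%N.

Definition prime_power (d : nat) : Prop :=
  exists p k : nat, [/\ prime p, (0 < k)%N & d = (p ^ k)%N].

(* Main.v *)
Require Import Defs.
From mathcomp Require Import all_boot all_order all_algebra boolp.
From mathcomp Require Import zify.

Set Implicit Arguments.
Unset Strict Implicit.
Unset Printing Implicit Defensive.

Import GRing.Theory.

(* Counting by primes, the right-hand side is the sum over primes [p <= N] of
   [min (d - 1) (N / p)].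

   Upper bound: if [p (d - 1) > N], at most [N / p] elements of [A] are
   multiples of [p]. The other elements of [A] have all their prime factors in
   [J = {p : p (d - 1) <= N}]; taking exponents modulo the prime power [d],
   Olson's theorem for the group [(Z/d)^J] bounds their number by
   [(d - 1) |J|].

   Lower bound: let [P] be the [d]-th prime. To each prime [p > P] attach the
   multiples [p j <= N] with [0 < j < d]. To each of the [d - 1] odd primes
   [q <= P] attach the [d] numbers [q 2^j], [0 <= j <= d], [j <> j0], where [j0]
   makes the sum of these exponents [j] congruent to 1 modulo [d]. In a product
   that is a [d]-th power no prime [p > P] occurs and each [q] occurs 0 or [d]
   times, so the exponent of 2 is congruent to the number of [q]'s that occur,
   which lies between 1 and [d - 1]. *)

(** * Olson's theorem by finite differences *)

Section FiniteDifferences.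
Local Open Scope ring_scope.
Variables (M : nmodType) (R : comNzRingType).
Implicit Types (f g : M -> R) (v x : M).

(** Polynomial degree below [n], expressed by the vanishing of all [n]-fold differences. Only
    translations of [M] enter, so [M] may be a monoid such as vectors of natural numbers. *)
Fixpoint degree_lt n f : Prop :=
  if n is n'.+1 then forall v, degree_lt n' (fun x => f (x + v) - f x)
  else forall x, f x = 0.

Lemma eq_degree_lt n f g : f =1 g -> degree_lt n f -> degree_lt n g.
Proof.
elim: n f g => [|n IHn] f g eqfg /= degf => [x|v]; first by rewrite -eqfg.
by apply: IHn (degf v) => x; rewrite !eqfg.
Qed.

Lemma degree_lt0 n f : (forall x, f x = 0) -> degree_lt n f.
Proof.
elim: n f => [|n IHn] //= f f0 v.
by apply: IHn => x; rewrite !f0 subrr.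
Qed.

Lemma degree_ltW m n f : (m <= n)%N -> degree_lt m f -> degree_lt n f.
Proof.
elim: m n f => [|m IHm] [|n] f // lemn degf; first exact: degree_lt0.
by move=> v; apply: IHm (degf v).
Qed.

Lemma degree_ltD n f g :
  degree_lt n f -> degree_lt n g -> degree_lt n (fun x => f x + g x).
Proof.
elim: n f g => [|n IHn] f g /= degf degg => [x|v].
  by rewrite degf degg addr0.
apply: eq_degree_lt (IHn _ _ (degf v) (degg v)) => x.
by rewrite opprD addrACA.
Qed.

Lemma degree_lt_shift n f w : degree_lt n f -> degree_lt n (fun x => f (x + w)).
Proof.
elim: n f => [|n IHn] f /= degf => [x|v]; first exact: degf.
by apply: eq_degree_lt (IHn _ (degf v)) => x; rewrite (addrAC x).
Qed.

(** Discrete Leibniz rule: the difference of [f * g] along [v] is [(f (x + v) - f x) * g (x + v) + f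
    x * (g (x + v) - g x)]. The predecessor appears because degrees at most [m - 1] and [n - 1] add
    up to at most [m + n - 2]. *)
Lemma degree_ltM m n f g : degree_lt m f -> degree_lt n g ->
  degree_lt (m + n).-1 (fun x => f x * g x).
Proof.
have [k] := ubnP (m + n).
elim: k m n f g => // k IHk [|m] [|n] f g lek degf degg;
  try by apply: degree_lt0 => x; rewrite ?degf ?degg ?mulr0 ?mul0r.
rewrite addSn addnS /= => v.
have degfv : degree_lt (m + n) (fun x => (f (x + v) - f x) * g (x + v)).
  rewrite -[(m + n)%N]/((m + n).+1.-1) -addnS.
  apply: (IHk m n.+1 _ (fun x => g (x + v))); [lia | exact: degf |].
  exact: degree_lt_shift.
have deggv : degree_lt (m + n) (fun x => f x * (g (x + v) - g x)).
  rewrite -[(m + n)%N]/((m + n).+1.-1) -addSn.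
  by apply: (IHk m.+1 n f); [lia | exact: degf | exact: degg].
apply: eq_degree_lt (degree_ltD degfv deggv) => x.
by rewrite mulrBl mulrBr addrA subrK.
Qed.

Lemma degree_lt_prod (J : Type) (r : seq J) n (F : J -> M -> R) :
    (forall j, degree_lt n.+1 (F j)) ->
  degree_lt (size r * n).+1 (fun x => \prod_(j <- r) F j x).
Proof.
move=> degF; elim: r => [|j r IHr].
  by move=> v x; rewrite !big_nil subrr.
rewrite mulSn -addnS -[(n + _)%N]/((n.+1 + (size r * n).+1).-1).
by apply: eq_degree_lt (degree_ltM (degF j) IHr) => x; rewrite big_cons.
Qed.

(** By Pascal's rule a unit step turns the lower index [n.+1] into [n]. A shift by [v] consists of
    [phi v] unit steps, and the offset [c] absorbs those already made. *)
Lemma degree_lt_bin (phi : M -> nat) c n :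
    (forall x y, phi (x + y) = (phi x + phi y)%N) ->
  degree_lt n.+1 (fun x => 'C(phi x + c, n)%:R).
Proof.
move=> phiD; elim: n c => [|n IHn] c v.
  by move=> x; rewrite !bin0 subrr.
suff degm m : degree_lt n.+1
    (fun x => 'C(phi x + m + c, n.+1)%:R - 'C(phi x + c, n.+1)%:R).
  by apply: eq_degree_lt (degm (phi v)) => x; rewrite phiD.
elim: m => [|m IHm]; first by apply: degree_lt0 => x; rewrite addn0 subrr.
apply: eq_degree_lt (degree_ltD IHm (IHn (m + c)%N)) => x.
by rewrite addnS addSn binS natrD addrAC addnA.
Qed.

(* Otherwise the alternating sum of [f] over all subsums would reduce to
   [f x] up to sign, although [size s] differences annihilate [f]. *)
Lemma degree_lt_subsum (I : eqType) (s : seq I) (v : I -> M) f x :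
    degree_lt (size s) f -> f x != 0 ->
  exists t, [/\ subseq t s, t != [::] & f (x + \sum_(i <- t) v i) != 0].
Proof.
elim: s f => [|i s IHs] f /= degf fx0; first by rewrite degf eqxx in fx0.
have [fxv|fxv] := eqVneq (f (x + v i)) 0; last first.
  by exists [:: i]; rewrite big_seq1 eqxx sub0seq.
(* The difference of [f] along [v i] equals [- f x] at [x], so the induction hypothesis applies to
   it. *)
have [|t [sts t0]] := IHs _ (degf (v i)); first by rewrite fxv sub0r oppr_eq0.
have [-> Hf|ft _] := eqVneq (f (x + \sum_(i <- t) v i)) 0; last first.
  by exists t; split=> //; apply: subseq_trans sts (subseq_cons s i).
exists (i :: t); rewrite /= eqxx sts; split=> //.
by rewrite big_cons addrCA addrC; rewrite subr0 in Hf.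
Qed.

End FiniteDifferences.

(** With [q = p ^ k], the identity [q * 'C(x + q - 1, q) = x * 'C(x + q - 1, q - 1)] shows that [q]
    divides the right side; if [p] did not divide the last binomial, [q] would divide [x]. *)
Lemma dvdn_bin_prime_pow p k x :
  prime p -> ~~ (p ^ k %| x) -> p %| 'C(x + (p ^ k).-1, (p ^ k).-1).
Proof.
move=> pr_p; apply: contraR => pNC.
have q_gt0 : 0 < p ^ k by rewrite expn_gt0 prime_gt0.
have := mul_bin_left (x + (p ^ k).-1) (p ^ k).-1.
rewrite prednK // addnK => Ebin.
have: p ^ k %| x * 'C(x + (p ^ k).-1, (p ^ k).-1) by rewrite -Ebin dvdn_mulr.
by rewrite Gauss_dvdl // coprimeXl // prime_coprime.
Qed.

(* Olson's theorem on the Davenport constant of [C_q ^ J], [q = p ^ k]. The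
   function [x |-> \prod_j 'C(x_j + q - 1, q - 1)] has degree at most
   [#|J| * (q - 1)] and is nonzero modulo [p] only where [q] divides all
   [x_j]. *)
Lemma zero_sum_subseq (I : eqType) (J : finType) p k (v : I -> J -> nat)
    (s : seq I) : prime p -> #|J| * (p ^ k).-1 < size s ->
  exists t, [/\ subseq t s, t != [::] &
    forall j, p ^ k %| \sum_(i <- t) v i j].
Proof.
move=> pr_p ltJs; set q := p ^ k.
pose F j (x : {ffun J -> nat}) : 'F_p := ('C(x j + q.-1, q.-1)%:R)%R.
have degF j : degree_lt q.-1.+1 (F j).
  by apply: degree_lt_bin => x y; rewrite ffunE.
have {degF} := degree_lt_prod (enum J) degF.
rewrite -cardE => /(degree_ltW ltJs) degs.
pose w i : {ffun J -> nat} := [ffun j => v i j].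
have [|t [sts t0 Ft]] := degree_lt_subsum w (x := 0%R) degs.
  (* At the origin each factor is ['C(q - 1, q - 1) = 1]. *)
  by rewrite prodf_seq_neq0; apply/allP => j _;
     rewrite /F ffunE add0n binn oner_eq0.
exists t; split=> // j; apply: contraR Ft => qNsum.
rewrite (bigD1_seq j) ?enum_uniq ?mem_enum //=.
rewrite add0r /F sum_ffunE (eq_bigr (fun i => v i j)) => [|i _]; last first.
  by rewrite ffunE.
by rewrite mulf_eq0 -(dvdn_pcharf (pchar_Fp pr_p)) dvdn_bin_prime_pow.
Qed.

(** * The upper bound *)

Lemma logn_prod (I : eqType) (r : seq I) (F : I -> nat) p :
  {in r, forall i, 0 < F i} ->
  logn p (\prod_(i <- r) F i) = \sum_(i <- r) logn p (F i).
Proof.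
elim: r => [|i r IHr] F_gt0; first by rewrite !big_nil logn1.
have F_gt0' : {in r, forall i, 0 < F i}.
  by move=> k kr; apply: F_gt0; rewrite inE kr orbT.
rewrite !big_cons lognM ?IHr ?F_gt0 ?mem_head //.
by rewrite big_seq; apply: prodn_cond_gt0.
Qed.

Lemma is_power_logn d n : 0 < d -> 0 < n ->
  (forall p, prime p -> d %| logn p n) -> exists x, n = x ^ d.
Proof.
move=> d_gt0 n_gt0 dvd_logn.
exists (\prod_(p <- primes n) p ^ (logn p n %/ d)).
rewrite {1}[n]prod_prime_decomp // prime_decompE big_map /=.
rewrite (big_morph (expn^~ d) (fun a b => expnMn a b d) (exp1n d)).
apply: eq_big_seq => p; rewrite mem_primes => /andP[pr_p _].
by rewrite -expnM divnK ?dvd_logn.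
Qed.

Lemma card_multiples_le N r :
  #|[set a : 'I_N.+1 | (0 < (a : nat)) && (r %| a)]| <= N %/ r.
Proof.
have [->|r_gt0] := posnP r.
  by rewrite eq_card0 // => a; rewrite !inE dvd0n; case: (val a).
rewrite -[N %/ r]card_ord.
apply: leq_trans (leq_imset_card (fun i : 'I_(N %/ r) => inord (r * i.+1)) _).
apply/subset_leq_card/subsetP => a; rewrite inE => /andP[a_gt0 /dvdnP[c ac]].
have c_gt0 : 0 < c by move: a_gt0; rewrite ac muln_gt0 => /andP[].
have lecN : c.-1 < N %/ r.
  by rewrite prednK // leq_divRL // -ac -ltnS.
apply/imsetP; exists (Ordinal lecN) => //=.
by apply: val_inj; rewrite prednK //= mulnC -ac inordK.
Qed.

Lemma card_dpower_free_le p k N (A : {set 'I_N.+1}) :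
    prime p -> {in A, forall a : 'I_N.+1, 0 < (a : nat)} ->
    dpower_free (p ^ k) A ->
  #|A| <= \sum_(0 <= r < N.+1 | prime r) minn (p ^ k).-1 (N %/ r).
Proof.
move=> pr_p A_gt0 Afree; set q := p ^ k in Afree *.
have q_gt0 : 0 < q by rewrite expn_gt0 prime_gt0.
pose multiples (r : nat) := [set a : 'I_N.+1 | (0 < (a : nat)) && (r %| a)].
pose B := \bigcup_(r : 'I_N.+1 | prime r && (N < q.-1 * r)) multiples r.
(* Elements of [A] in [B] are charged to the primes where the minimum is [N %/ r], the others to the
   primes where it is [q.-1]. *)
rewrite big_mkord (bigID (fun r : 'I_N.+1 => N < q.-1 * r)) /= -(cardsID B A).
apply: leq_add.
  apply: leq_trans (subset_leq_card (subsetIr A B)) _.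
  apply: (@leq_trans
    (\sum_(r : 'I_N.+1 | prime r && (N < q.-1 * r)) #|multiples r|)).
    apply: (big_rec2 (fun (C : {set 'I_N.+1}) m => #|C| <= m)).
      by rewrite cards0.
    by move=> r C m _ leCm; rewrite cardsU (leq_trans (leq_subr _ _)) // leq_add2l.
  apply: leq_sum => r /andP[pr_r ltN].
  rewrite (minn_idPr _) ?card_multiples_le //.
  by rewrite ltnW // ltn_divLR ?prime_gt0.
pose J : finType := {r : 'I_N.+1 | prime r && ~~ (N < q.-1 * r)}.
have ->: \sum_(r < N.+1 | prime r && ~~ (N < q.-1 * r)) minn q.-1 (N %/ r)
         = #|{: J}| * q.-1.
  rewrite card_sig -sum_nat_const; apply: eq_big => // r /andP[pr_r].
  by rewrite -leqNgt => leN; rewrite (minn_idPl _) // leq_divRL ?prime_gt0.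
rewrite leqNgt cardE; apply/negP => ltJ.
have [t [sts t0 dvdt]] :=
  zero_sum_subseq (k := k) (fun (a : 'I_N.+1) (j : J) => logn (val j) a)
    pr_p ltJ.
have sAB a : a \in t -> a \in A :\: B.
  by move=> /(mem_subseq sts); rewrite mem_enum.
have sA a : a \in t -> a \in A by move=> /sAB; rewrite inE => /andP[].
have t_gt0 : {in t, forall a : 'I_N.+1, 0 < (a : nat)}.
  by move=> a /sA; apply: A_gt0.
have prod_gt0 : 0 < \prod_(a <- t) (a : nat).
  by rewrite big_seq; apply: prodn_cond_gt0.
have [r pr_r|x Ex] := is_power_logn q_gt0 prod_gt0; last first.
  apply: (Afree t t0 (subseq_uniq sts (enum_uniq _)) sA); exists x%:Z%R.
  by rewrite Ex -natz natrX natz.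
rewrite logn_prod //.
have [/andP[ltrN leN]|/andP big_r] := boolP ((r < N.+1) && (q.-1 * r <= N)).
  have jP : prime (Ordinal ltrN) && ~~ (N < q.-1 * Ordinal ltrN).
    by rewrite /= pr_r -leqNgt.
  exact: (dvdt (Sub (Ordinal ltrN) jP)).
(* A prime [r] outside [J] divides no element of [t]: dividing [a], it would be at most [N], hence
   one of the primes defining [B], while [t] avoids [B]. *)
rewrite big_seq big1 // => a at_.
apply/eqP; rewrite -leqn0 leqNgt logn_gt0 mem_primes pr_r t_gt0 //=.
apply/negP => ra; apply: big_r.
have ltrN : r < N.+1 := leq_ltn_trans (dvdn_leq (t_gt0 _ at_) ra) (ltn_ord a).
split=> //; rewrite leqNgt; apply/negP => ltN.
have /setDP[_ /negP[]] := sAB _ at_.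
by apply/bigcupP; exists (Ordinal ltrN); rewrite /= ?pr_r // inE ra t_gt0.
Qed.

(** * Counting primes *)

Lemma next_primeP m :
  [/\ prime (next_prime m), m < next_prime m &
      forall p, prime p -> m < p -> next_prime m <= p].
Proof.
rewrite /next_prime; case: ex_minnP => q /andP[pr_q ltmq] minq.
by split=> // p pr_p ltmp; apply: minq; rewrite pr_p.
Qed.

Lemma prime_nth_prime d : 0 < d -> prime (nth_prime d).
Proof. by case: d => // d _; case: (next_primeP (nth_prime d)). Qed.

Lemma ltn_nth_prime d : 0 < d -> d < nth_prime d.
Proof.
elim: d => // -[_ _|d IHd _]; first exact: prime_gt1 (prime_nth_prime _).
apply: leq_ltn_trans (IHd isT) _.
by case: (next_primeP (nth_prime d.+1)).
Qed.

Lemma count_prime_nth_prime d :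
  count prime (index_iota 0 (nth_prime d).+1) = d.
Proof.
elim: d => [//|d IHd]; have [pr_q ltq minq] := next_primeP (nth_prime d).
rewrite -[nth_prime d.+1]/(next_prime (nth_prime d)).
set q := next_prime _ in pr_q ltq minq *.
have ->: index_iota 0 q.+1 =
    index_iota 0 (nth_prime d).+1 ++ rcons (index_iota (nth_prime d).+1 q) q.
  rewrite /index_iota !subn0 -cats1 catA -iotaD.
  have -> : (nth_prime d).+1 + (q - (nth_prime d).+1) = q by lia.
  by rewrite -addn1 iotaD.
rewrite count_cat IHd -cats1 count_cat /= pr_q addn0.
rewrite (@eq_in_count _ _ pred0) ?count_pred0 ?addn1 // => p.
rewrite mem_index_iota => /andP[ltp ltpq]; apply/negP => pr_p.
by move: ltpq; rewrite ltnNge minq.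
Qed.

(** For a prime [p], both [p <= N / k] and [k <= N %/ p] say [p * k <= N]. The second form puts all
    [k] over one common range of primes, so that sums can be exchanged. *)
Lemma primepi_divE N k : 0 < k ->
  primepi (N%:R / k%:R : rat)%R = \sum_(0 <= p < N.+1 | prime p) (k <= N %/ p).
Proof.
move=> k_gt0; rewrite /primepi.
have ratk_gt0 : (0 < k%:R :> rat)%R by rewrite Num.Theory.ltr0n.
have ->: Num.truncn (N%:R / k%:R : rat)%R = N %/ k.
  apply: Num.Theory.truncn_def.
  rewrite Num.Theory.ler_pdivlMr // Num.Theory.ltr_pdivrMr // -!natrM.
  by rewrite Num.Theory.ler_nat Num.Theory.ltr_nat leq_divM ltn_ceil.
rewrite -sum1_card (eq_bigl (fun p : 'I_(N %/ k).+1 => prime p));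
  last first.
  move=> p; rewrite inE Num.Theory.ler_pdivlMr // -natrM Num.Theory.ler_nat.
  by rewrite -leq_divRL // -ltnS ltn_ord andbT.
rewrite -(big_mkord prime (fun=> 1)) -big_mkcondr /=.
rewrite (big_nat_widen _ _ N.+1) ?ltnS ?leq_div //.
rewrite big_seq_cond [RHS]big_seq_cond; apply: eq_bigl => p.
have [pr_p|] := boolP (prime p); last by rewrite !andbF.
by rewrite ltnS leq_divRL // mulnC -leq_divRL ?prime_gt0.
Qed.

Lemma sum_primepi_div d N :
  \sum_(1 <= k < d) primepi (N%:R / k%:R : rat)%R =
  \sum_(0 <= p < N.+1 | prime p) minn d.-1 (N %/ p).
Proof.
rewrite big_nat_cond.
rewrite (eq_bigr (fun k => \sum_(0 <= p < N.+1 | prime p) (k <= N %/ p)));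
  last first.
  by move=> k /andP[/andP[k_gt0 _] _]; apply: primepi_divE.
rewrite -big_nat_cond exchange_big; apply: eq_bigr => p _ /=.
elim: d => [|d]; first by rewrite big_geq ?min0n.
case: d => [|d] IHd; first by rewrite big_geq ?min0n.
rewrite big_nat_recr // IHd /=; case: leqP; lia.
Qed.

(** * The extremal set *)

Lemma logn_le1_dvdn p n : prime p -> 0 < n -> logn p n <= 1 ->
  logn p n = (p %| n).
Proof.
move=> pr_p n_gt0; have := logn_gt0 p n; rewrite mem_primes pr_p n_gt0 /= => <-.
by case: (logn p n) => [|[]].
Qed.

Section ExtremalSet.
Variables d N : nat.
Hypotheses (d_gt1 : 1 < d) (hN : 2 ^ d * nth_prime d <= N).
Let P := nth_prime d.

Let d_gt0 : 0 < d. Proof. exact: ltnW. Qed.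
Let ltdP : d < P. Proof. exact: ltn_nth_prime. Qed.

(* The [j0] above: the remaining exponents sum to 1 modulo [d]. *)
Definition omitted := (sumn (iota 0 d.+1) + d.-1) %% d.
Definition exponents := [seq j <- iota 0 d.+1 | j != omitted].
Definition odd_primes := [seq p <- index_iota 3 P.+1 | prime p].
Definition large_primes := [seq p <- index_iota P.+1 N.+1 | prime p].
Definition small_part := [seq q * 2 ^ j | q <- odd_primes, j <- exponents].
Definition large_part :=
  [seq p * j | p <- large_primes, j <- iota 1 (minn d.-1 (N %/ p))].
Definition extremal := small_part ++ large_part.

Lemma uniq_exponents : uniq exponents.
Proof. by rewrite filter_uniq ?iota_uniq. Qed.

Lemma mem_omitted : omitted \in iota 0 d.+1.
Proof. by rewrite mem_iota /= add0n ltnS ltnW // ltn_pmod. Qed.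

Lemma size_exponents : size exponents = d.
Proof.
have := count_predC (pred1 omitted) (iota 0 d.+1).
rewrite size_filter size_iota (count_uniq_mem _ (iota_uniq _ _)) mem_omitted.
by case.
Qed.

(** The choice of [omitted], in which [d.-1] acts as -1, makes the sum congruent to 1 modulo [d]; a
    common divisor then divides both [d] and [d.-1]. *)
Lemma coprime_sum_exponents : coprime d (\sum_(j <- exponents) j).
Proof.
have Esum : \sum_(j <- exponents) j + omitted = sumn (iota 0 d.+1).
  rewrite sumnE (bigD1_seq omitted mem_omitted (iota_uniq _ _)) /= [RHS]addnC.
  by rewrite big_filter.
have: d %| \sum_(j <- exponents) j + d.-1.
  have: \sum_(j <- exponents) j + d.-1 + omitted == 0 + omitted %[mod d].
    by rewrite addnAC Esum add0n /omitted modn_mod.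
  by rewrite eqn_modDr mod0n.
move=> dvd_sum; rewrite /coprime -dvdn1; set g := gcdn _ _.
have g_d : g %| d := dvdn_gcdl _ _.
have g_pred : g %| d.-1.
  by rewrite -(dvdn_addr _ (dvdn_gcdr d _)) (dvdn_trans g_d).
by rewrite -(dvdn_addr _ g_pred) addn1 prednK.
Qed.

Lemma prime_odd_primes q : q \in odd_primes -> prime q.
Proof. by rewrite mem_filter => /andP[]. Qed.

Lemma odd_primes_gt2 q : q \in odd_primes -> 2 < q.
Proof. by rewrite mem_filter mem_index_iota => /and3P[]. Qed.

Lemma odd_primes_le q : q \in odd_primes -> q <= P.
Proof. by rewrite mem_filter mem_index_iota => /and3P[]. Qed.

Lemma size_odd_primes : size odd_primes = d.-1.
Proof.
have := count_prime_nth_prime d; rewrite size_filter.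
(* Of 0, 1, 2 only 2 is prime, so cutting them off costs one of the [d] primes up to [P]. *)
have -> : index_iota 0 (nth_prime d).+1 = [:: 0; 1; 2] ++ index_iota 3 P.+1.
  rewrite -[[:: 0; 1; 2]]/(index_iota 0 3) /index_iota !subn0 -iotaD subnKC //.
  by rewrite ltnS (leq_trans _ ltdP).
by rewrite count_cat /= => <-.
Qed.

Lemma large_primesP p : p \in large_primes -> prime p /\ P < p.
Proof. by rewrite mem_filter mem_index_iota => /and3P[]. Qed.

Lemma logn_small q j r : q \in odd_primes -> prime r -> 2 < r ->
  logn r (q * 2 ^ j) = (r == q).
Proof.
move=> q_odd pr_r r_gt2; have pr_q := prime_odd_primes q_odd.
rewrite lognM ?expn_gt0 ?prime_gt0 // lognX !logn_prime //.
by rewrite (gtn_eqF r_gt2) muln0 addn0.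
Qed.

Lemma logn2_small q j : q \in odd_primes -> logn 2 (q * 2 ^ j) = j.
Proof.
move=> q_odd; have pr_q := prime_odd_primes q_odd.
rewrite lognM ?expn_gt0 ?prime_gt0 // lognX !logn_prime // muln1.
by rewrite (ltn_eqF (odd_primes_gt2 q_odd)).
Qed.

Lemma mem_factors p j : j \in iota 1 (minn d.-1 (N %/ p)) ->
  [/\ 0 < j, j < d & p * j <= N].
Proof.
rewrite mem_iota add1n ltnS leq_min => /and3P[j_gt0 lejd lejN]; split=> //.
  by rewrite -(prednK d_gt0).
by rewrite mulnC (leq_trans _ (leq_divM N p)) ?leq_mul2r ?lejN ?orbT.
Qed.

(** Since [j < d < P < r], the prime [r] cannot divide [j]. *)
Lemma logn_large p j r : p \in large_primes -> 0 < j < d -> prime r -> P < r ->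
  logn r (p * j) = (r == p).
Proof.
move=> /large_primesP[pr_p ltPp] /andP[j_gt0 ltjd] pr_r ltPr.
rewrite lognM ?(prime_gt0 pr_p) // logn_prime // logn_coprime ?addn0 //.
rewrite prime_coprime // gtnNdvd //.
exact: ltn_trans ltjd (ltn_trans ltdP ltPr).
Qed.

Lemma mem_extremalP a : a \in extremal ->
  (exists q j, [/\ q \in odd_primes, j \in exponents & a = q * 2 ^ j]) \/
  (exists p j, [/\ p \in large_primes, 0 < j < d, p * j <= N & a = p * j]).
Proof.
rewrite mem_cat => /orP[] /allpairsPdep[p [j [p_in j_in ->]]].
  by left; exists p, j.
  have [j_gt0 ltjd lepj] := mem_factors j_in.
  by right; exists p, j; rewrite j_gt0.
Qed.

Lemma extremal_gt0 a : a \in extremal -> 0 < a.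
Proof.
case/mem_extremalP=> [[q [j [/prime_odd_primes pr_q _ ->]]]|].
  by rewrite muln_gt0 expn_gt0 prime_gt0.
move=> [p [j [/large_primesP[pr_p _] /andP[j_gt0 _] _ ->]]].
by rewrite muln_gt0 prime_gt0.
Qed.

Lemma extremal_le a : a \in extremal -> a <= N.
Proof.
case/mem_extremalP=> [[q [j [q_odd j_exp ->]]]|[p [j [_ _ lepj ->]]] //].
apply: leq_trans hN; rewrite mulnC leq_mul ?odd_primes_le // leq_exp2l //.
by move: j_exp; rewrite mem_filter mem_iota add0n ltnS => /and3P[].
Qed.

(** A prime above [P] enters every element at most once, so its exponent in a product of elements
    counts the multiples among them. *)
Lemma logn_extremal a r : a \in extremal -> prime r -> P < r ->
  logn r a = (r %| a).
Proof.
move=> a_in pr_r ltPr; apply: logn_le1_dvdn => //; first exact: extremal_gt0.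
case/mem_extremalP: a_in => [[q [j [q_odd _ ->]]]|[p [j [p_large j_in _ ->]]]].
  rewrite logn_small ?leq_b1 // (leq_trans _ ltPr) //.
  by rewrite ltnS ltnW // (leq_ltn_trans d_gt1).
by rewrite logn_large ?leq_b1.
Qed.

(** The exponent of 2 recovers [j], and cancelling [2 ^ j] recovers [q]. A general [Q] is allowed in
    order to cover the primes that occur in a given product. *)
Lemma uniq_small (Q : seq nat) : {subset Q <= odd_primes} -> uniq Q ->
  uniq [seq q * 2 ^ j | q <- Q, j <- exponents].
Proof.
move=> Q_odd Q_uniq; apply: allpairs_uniq => //; first exact: uniq_exponents.
move=> u u' /allpairsP[[q i] /= [/Q_odd q_odd _ ->]].
move=> /allpairsP[[r j] /= [/Q_odd r_odd _ ->]] /= Eqr.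
have Eij : i = j by rewrite -(logn2_small i q_odd) Eqr logn2_small.
by move: Eqr; rewrite Eij => /eqP; rewrite eqn_pmul2r ?expn_gt0 // => /eqP->.
Qed.

Lemma uniq_extremal : uniq extremal.
Proof.
rewrite cat_uniq; apply/and3P; split.
- by apply: uniq_small => //; rewrite filter_uniq ?iota_uniq.
(* The two parts are disjoint: [p > P] has exponent 1 in [p * j] and exponent 0 in every
   [q * 2 ^ i]. *)
- apply/hasPn => _ /allpairsPdep[p [j [p_large /mem_factors[j_gt0 ltjd _] ->]]].
  apply/allpairsPdep => -[q [i [q_odd _ Eqi]]].
  have [pr_p ltPp] := large_primesP p_large.
  have := logn_large p_large (introT andP (conj j_gt0 ltjd)) pr_p ltPp.
  have p_gt2 : 2 < p by rewrite (leq_ltn_trans d_gt1) // (ltn_trans ltdP).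
  rewrite Eqi logn_small // eqxx.
  by rewrite (gtn_eqF (leq_ltn_trans (odd_primes_le q_odd) ltPp)).
- apply: allpairs_uniq_dep => [|p _|]; rewrite ?filter_uniq ?iota_uniq //.
  move=> u u' /allpairsPdep[p [j [p_large /mem_factors[j_gt0 ltjd _] ->]]].
  move=> /allpairsPdep[p' [j' [p'_large /mem_factors[j'_gt0 ltj'd _] ->]]].
  move=> /= Epj.
  have [pr_p ltPp] := large_primesP p_large.
  have := logn_large p_large (introT andP (conj j_gt0 ltjd)) pr_p ltPp.
  rewrite Epj logn_large ?j'_gt0 // eqxx.
  case: eqVneq Epj => // <- /eqP; rewrite eqn_pmul2l ?prime_gt0 // => /eqP-> _.
  by [].
Qed.

Lemma logn_sum_extremal (s : seq nat) r : {subset s <= extremal} ->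
  {in s, forall a, logn r a = (r %| a)} ->
  logn r (\prod_(a <- s) a) = count (dvdn r) s.
Proof.
move=> s_ext s_logn; rewrite logn_prod => [|a /s_ext]; last exact: extremal_gt0.
rewrite (eq_big_seq _ s_logn) -sum1_count [RHS]big_mkcond.
by apply: eq_bigr => a _; case: (_ %| _).
Qed.

Lemma extremal_power_free (s : seq nat) x : s != [::] -> uniq s ->
  {subset s <= extremal} -> \prod_(a <- s) a != x ^ d.
Proof.
move=> s0 s_uniq s_ext; apply/eqP => Ex.
have dvd_logn r : d %| logn r (\prod_(a <- s) a) by rewrite Ex lognX dvdn_mulr.
have [/hasP[a a_s a_large]|/hasPn s_small] := boolP (has (mem large_part) s).
  have /allpairsPdep[p [j [p_large _ Ea]]] := a_large.
  have [pr_p ltPp] := large_primesP p_large.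
  have := dvd_logn p; rewrite logn_sum_extremal //; last first.
    by move=> b /s_ext b_ext; apply: logn_extremal.
  have count_gt0 : 0 < count (dvdn p) s.
    by rewrite -has_count; apply/hasP; exists a; rewrite // Ea dvdn_mulr.
  (* Being positive and divisible by [d], the number of multiples of [p] in [s] is at least [d]; yet
     they all lie among the [d.-1] numbers [p * i] with [0 < i < d]. *)
  move=> /(dvdn_leq count_gt0); rewrite leqNgt => /negP[].
  rewrite -[d in _ < d]prednK // ltnS.
  suff: size (filter (dvdn p) s) <= size [seq p * i | i <- iota 1 d.-1].
    by rewrite size_filter size_map size_iota.
  apply: uniq_leq_size => [|b]; first exact: filter_uniq.
  rewrite mem_filter => /andP[pb /s_ext /mem_extremalP[]].
    move=> [q [i [q_odd _ Eb]]].
    have p_gt2 : 2 < p by rewrite (leq_ltn_trans d_gt1) // (ltn_trans ltdP).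
    have : 0 < logn p b.
      rewrite Eb in pb *; rewrite logn_gt0 mem_primes pr_p pb muln_gt0 expn_gt0.
      by rewrite (prime_gt0 (prime_odd_primes q_odd)).
    rewrite Eb logn_small //.
    by rewrite (gtn_eqF (leq_ltn_trans (odd_primes_le q_odd) ltPp)).
  move=> [p' [i [p'_large /[dup] i_in /andP[i_gt0 ltid] lepiN Eb]]].
  have : 0 < logn p b.
    have [pr_p' _] := large_primesP p'_large.
    rewrite Eb in pb *; rewrite logn_gt0 mem_primes pr_p pb muln_gt0 i_gt0.
    by rewrite prime_gt0.
  rewrite Eb logn_large //; case: eqP => // <- _.
  by rewrite map_f // mem_iota i_gt0 add1n prednK.
have s_smallP a : a \in s ->
    exists q j, [/\ q \in odd_primes, j \in exponents & a = q * 2 ^ j].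
  move=> a_s; apply/allpairsPdep; have := s_small a a_s.
  by have := s_ext a a_s; rewrite mem_cat => /orP[] //= ->.
have dvdE q r j : q \in odd_primes -> r \in odd_primes ->
    (q %| r * 2 ^ j) = (q == r).
  move=> q_odd r_odd; have pr_q := prime_odd_primes q_odd.
  have pr_r := prime_odd_primes r_odd.
  rewrite Euclid_dvdM // Euclid_dvdX // !dvdn_prime2 //.
  by rewrite (gtn_eqF (odd_primes_gt2 q_odd)) orbF.
pose block q := [seq q * 2 ^ j | j <- exponents].
have sub_block q : q \in odd_primes -> {subset filter (dvdn q) s <= block q}.
  move=> q_odd a; rewrite mem_filter => /andP[qa].
  move=> /s_smallP[r [j [r_odd j_exp Ea]]].
  by move: qa; rewrite Ea dvdE // => /eqP->; apply: map_f.
(* The number of multiples of [q] in [s] is a positive multiple of [d], and the block of [q] has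
   only [d] elements, so all of them are in [s]. *)
have block_sub q : q \in odd_primes -> has (dvdn q) s -> {subset block q <= s}.
  move=> q_odd; rewrite has_count => count_gt0 a a_block.
  have := dvd_logn q.
  rewrite logn_sum_extremal // => [/(dvdn_leq count_gt0) led|b b_s].
    have leb : size (block q) <= size (filter (dvdn q) s).
      by rewrite size_map size_exponents size_filter.
    have [_ Eblock] :=
      uniq_min_size (filter_uniq _ s_uniq) (sub_block q q_odd) leb.
    by move: a_block; rewrite -Eblock mem_filter => /andP[].
  apply: logn_le1_dvdn; rewrite ?prime_odd_primes ?extremal_gt0 ?s_ext //.
  have [r [j [r_odd _ ->]]] := s_smallP b b_s.
  by rewrite logn_small ?leq_b1 ?prime_odd_primes ?odd_primes_gt2.
pose Q := [seq q <- odd_primes | has (dvdn q) s].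
have Q_odd q : q \in Q -> q \in odd_primes by rewrite mem_filter => /andP[].
have perm_s : perm_eq s [seq q * 2 ^ j | q <- Q, j <- exponents].
  apply: uniq_perm => //.
    by apply: uniq_small => //; rewrite !filter_uniq ?iota_uniq.
  move=> a; apply/idP/allpairsPdep => [a_s|[q [j [q_Q j_exp ->]]]].
    have [q [j [q_odd j_exp Ea]]] := s_smallP a a_s; exists q, j; split=> //.
    rewrite mem_filter q_odd andbT; apply/hasP; exists a => //.
    by rewrite Ea dvdn_mulr.
  have q_odd := Q_odd q q_Q; apply: (block_sub q) => //; last exact: map_f.
  by move: q_Q; rewrite mem_filter => /andP[].
have := dvd_logn 2; rewrite logn_prod => [|a /s_ext]; last exact: extremal_gt0.
rewrite (perm_big _ perm_s) big_allpairs_dep /=.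
rewrite (eq_big_seq (fun=> \sum_(j <- exponents) j)); last first.
  by move=> q /Q_odd q_odd; apply: eq_bigr => j _; rewrite logn2_small.
rewrite big_const_seq count_predT iter_addn_0.
(* The exponent of 2 is [size Q] times a number coprime to [d], so [d] divides [size Q]. *)
rewrite Gauss_dvdr ?coprime_sum_exponents //.
have Q_gt0 : 0 < size Q.
  have [a] : exists a, a \in s.
    by case: (s) s0 => // a s' _; exists a; apply: mem_head.
  by rewrite (perm_mem perm_s) => /allpairsPdep[q [_ [+ _ _]]]; case: (Q).
move=> /(dvdn_leq Q_gt0); rewrite leqNgt => /negP[].
rewrite -[d in _ < d]prednK // ltnS -size_odd_primes.
by rewrite size_filter count_size.
Qed.

Lemma size_extremal :
  size extremal = \sum_(0 <= p < N.+1 | prime p) minn d.-1 (N %/ p).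
Proof.
have leP1N : P.+1 <= N.+1.
  by rewrite ltnS (leq_trans _ hN) // leq_pmull ?expn_gt0.
rewrite size_cat size_allpairs size_odd_primes size_exponents size_allpairs_dep.
rewrite (@big_cat_nat _ _ _ P.+1) //=; congr (_ + _); last first.
  rewrite sumnE big_map big_filter; apply: eq_bigr => p _.
  by rewrite size_iota.
(* The small part matches the [d] primes up to [P], 2 included; each contributes [d.-1] because
   [p * (d - 1) <= P * 2 ^ d <= N]. *)
have -> : d.-1 * d = \sum_(0 <= p < P.+1 | prime p) d.-1.
  by rewrite big_const_seq iter_addn_0 count_prime_nth_prime.
rewrite big_nat_cond [RHS]big_nat_cond; apply: eq_bigr => p.
move=> /andP[/andP[_ ltpP] pr_p]; apply/esym/minn_idPl.
rewrite leq_divRL ?prime_gt0 //; apply: leq_trans hN; rewrite leq_mul //.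
by rewrite (leq_trans (leq_pred d)) // ltnW // ltn_expl.
Qed.

End ExtremalSet.

(** * The lower bound and the theorem *)

Lemma sum_le_rho d N : 1 < d -> 2 ^ d * nth_prime d <= N ->
  \sum_(0 <= p < N.+1 | prime p) minn d.-1 (N %/ p) <= rho d N.
Proof.
move=> d_gt1 hN; rewrite -(size_extremal d_gt1 hN).
pose A := [set a : 'I_N.+1 | val a \in extremal d N].
have <- : #|A| = size (extremal d N).
  rewrite cardE -(size_map val); apply/perm_size/uniq_perm.
  - by rewrite map_inj_uniq ?enum_uniq //; apply: val_inj.
  - exact: uniq_extremal.
  move=> a; apply/mapP/idP => [[b + ->]|a_ext]; first by rewrite mem_enum inE.
  have ltaN : a < N.+1 by rewrite ltnS; apply: extremal_le a_ext.
  by exists (Ordinal ltaN); rewrite // mem_enum inE.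
apply: leq_bigmax_cond; apply/andP; split.
  by apply/forall_inP => a; rewrite inE => /(extremal_gt0 d_gt1).
apply/asboolP => s s0 s_uniq sA [x Ex].
(* The integer [x] may be negative; absolute values turn the equation into one between natural
   numbers. *)
have /eqP[] : \prod_(a <- map val s) a != `|x| ^ d.
  apply: (extremal_power_free d_gt1 (N := N)).
  - by case: (s) s0.
  - by rewrite map_inj_uniq //; apply: val_inj.
  - by move=> _ /mapP[a /sA + ->]; rewrite inE.
by rewrite big_map -abszX -Ex.
Qed.

Theorem theorem2 (d N : nat) (hd2 : 2 <= d) (hd : prime_power d)
    (hN : 2 ^ d * nth_prime d <= N) :
  rho d N = \sum_(1 <= k < d) primepi (N%:R / k%:R : rat)%R.
Proof.
rewrite sum_primepi_div; apply/eqP; rewrite eqn_leq sum_le_rho // andbT.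
apply/bigmax_leqP => A /andP[/forall_inP A_gt0 /asboolP A_free].
have [p [k [pr_p _ Ed]]] := hd.
by rewrite Ed in A_free *; apply: card_dpower_free_le.
Qed.
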